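(* Let $n\ge2$, $d=\lfloor(4n-2)/3\rfloor$ and $m=2n+1+3(d-n)$. Consider the fair division instance with $n$ agents and goods $[m]=\{1,\dots,m\}$ in which all agents have the same additive valuation $u$ given by $$u(j)=\begin{cases}\dfrac23-\dfrac{\lceil j/2\rceil}{3n}&\text{if }1\le j\le2n,\\[2mm] \dfrac13&\text{if }2n<j\le m.\end{cases}$$ Then this instance is ordered and $d$-normalized.
   Context: An instance with goods $[m]$ is ordered if there is an ordering $g_1,\dots,g_m$ of the goods such that every agent $i$ has $v_i(g_1)\ge\dots\ge v_i(g_m)$. It is $d$-normalized if for every agent $i$ there is a partition $(P_1,\dots,P_d)$ of $[m]$ into $d$ bundles with $v_i(P_j)=1$ for all $j\in\{1,\dots,d\}$. Valuations are additive: $v_i(S)=\sum_{g\in S}v_i(g)$. *)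

(* Defs.v *)
From mathcomp Require Import all_boot all_order all_fingroup all_algebra.
Set Implicit Arguments.
Unset Strict Implicit.
Unset Printing Implicit Defensive.
Import Order.TTheory GRing.Theory Num.Theory.
Local Open Scope ring_scope.

(* The goods {1, ..., m} are encoded as 'I_m: the ordinal g stands for good
   number g.+1. An additive valuation is given by its values on single goods. *)
Definition instance (R : realFieldType) (n m : nat) := 'I_n -> 'I_m -> R.

Definition bundle_value (R : realFieldType) (m : nat) (v : 'I_m -> R)
    (S : {set 'I_m}) : R :=
  \sum_(g in S) v g.

(* The permutation s is the ordering: s k is the good in position k. *)
Definition ordered (R : realFieldType) (n m : nat) (v : instance R n m) : Prop :=
  exists s : 'S_m, forall (i : 'I_n) (j k : 'I_m),
    (j <= k)%N -> v i (s k) <= v i (s j).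

Definition bundle_partition (m d : nat) (P : 'I_d -> {set 'I_m}) : Prop :=
  \bigcup_(j < d) P j = [set: 'I_m] /\
  (forall j k : 'I_d, j != k -> [disjoint P j & P k]).

Definition normalized (R : realFieldType) (n m d : nat) (v : instance R n m) :
    Prop :=
  forall i : 'I_n, exists P : 'I_d -> {set 'I_m},
    bundle_partition P /\ (forall j : 'I_d, bundle_value (v i) (P j) = 1).

(* j is the 1-based number of the good, and uphalf j is the ceiling of j / 2. *)
Definition u (R : realFieldType) (n j : nat) : R :=
  if (1 <= j <= 2 * n)%N then 2 / 3 - (uphalf j)%:R / (3 * n%:R) else 1 / 3.

Definition identical_instance (R : realFieldType) (n m : nat) : instance R n m :=
  fun (_ : 'I_n) (g : 'I_m) => u R n g.+1.

Arguments identical_instance R n m : clear implicits.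

(* Main.v *)
(** The goods worth [1/3] are those numbered [2n-1, ..., m]; there are
    [3 (d - n + 1)] of them, so they form [d - n + 1] triples of value [1]. For
    [1 <= k <= n - 1] there are two goods of value [2/3 - k/(3n)]; pairing the
    first one of index [k] with the second one of index [n - k] gives [n - 1]
    further bundles of value [4/3 - n/(3n) = 1]. *)
Require Import Defs.
From mathcomp Require Import all_boot all_order all_fingroup all_algebra.
From mathcomp Require Import zify ring lra.
Set Implicit Arguments.
Unset Strict Implicit.
Unset Printing Implicit Defensive.
Import Order.TTheory GRing.Theory Num.Theory.
Local Open Scope ring_scope.

(** Reduces the value of a bundle, given by a predicate, to a sum over an explicit list of its two
    or three goods. *)
Lemma sum_ord_seq (V : nmodType) (m : nat) (A : pred nat) (F : nat -> V)
    (r : seq nat) :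
  uniq r -> (forall x, (x \in r) = (x < m)%N && A x) ->
  \sum_(g < m | A g) F g = \sum_(x <- r) F x.
Proof.
move=> r_uniq mem_r.
rewrite -(big_mkord A F) -big_filter; apply: perm_big; apply: uniq_perm => //.
  by rewrite filter_uniq // iota_uniq.
by move=> x; rewrite mem_filter mem_index_iota mem_r leq0n andbC.
Qed.

Lemma u_big (R : realFieldType) (n g : nat) :
  (g < 2 * n)%N -> u R n g.+1 = 2 / 3 - (g./2.+1)%:R / (3 * n%:R).
Proof. by move=> lt_g; rewrite /u /= lt_g. Qed.

(** The range starts at [2 * n - 2] because the two goods of index [n] are also worth
    [2/3 - n/(3n) = 1/3]. *)
Lemma u_third (R : realFieldType) (n g : nat) :
  (0 < n)%N -> (2 * n - 2 <= g)%N -> u R n g.+1 = 1 / 3.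
Proof.
move=> n_gt0 le_g; have [lt_g|ge_g] := ltnP g (2 * n)%N; last first.
  by rewrite /u /= ltnNge ge_g.
rewrite u_big //; have -> : g./2.+1 = n by lia.
have : n%:R != 0 :> R by rewrite pnatr_eq0 -lt0n.
by move=> n_neq0; field.
Qed.

Lemma u_nonincreasing (R : realFieldType) (n j k : nat) :
  (0 < n)%N -> (j <= k)%N -> u R n k.+1 <= u R n j.+1.
Proof.
move=> n_gt0 le_jk.
have [lt_k|ge_k] := ltnP k (2 * n)%N.
  rewrite !u_big //; last exact: leq_ltn_trans lt_k.
  rewrite lerD2l lerN2 ler_wpM2r ?invr_ge0 ?mulr_ge0 ?ler0n //.
  by rewrite ler_nat ltnS half_leq.
rewrite (u_third R n_gt0 (g := k)); last by lia.
have [lt_j|ge_j] := ltnP j (2 * n)%N; last by rewrite u_third //; lia.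
(* Here [k] is worth [1/3], and [j] is worth at least that because its index is at most [n]. *)
rewrite u_big // lerBrDr -lerBrDl ler_pdivrMr ?mulr_gt0 ?ltr0n //.
have : (j./2.+1)%:R <= n%:R :> R by rewrite ler_nat; lia.
by lra.
Qed.

(* Bundle of the good [g.+1]: pair [k] has label [k - 1], where the good has
   index [k = g./2 + 1] if [g] is even and [n - k = g./2 + 1] if [g] is odd. *)
Definition bundle_of (n g : nat) : nat :=
  if (g < 2 * n - 2)%N then if odd g then (n - 2 - g./2)%N else g./2
  else (n - 1 + (g - (2 * n - 2)) %/ 3)%N.

(** From [2 * n - 2] on there are [3 * (d - n + 1)] goods, so the triples use exactly the labels
    [n - 1] to [d - 1]. *)
Lemma bundle_of_lt (n d g : nat) :
  (0 < n <= d)%N -> (g < 2 * n + 1 + 3 * (d - n))%N -> (bundle_of n g < d)%N.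
Proof. by rewrite /bundle_of => hd lt_g; do 2?case: ifP; lia. Qed.

Lemma pair_value (R : realFieldType) (n m j : nat) :
  (2 * n - 2 <= m)%N -> (j < n - 1)%N ->
  \sum_(g < m | bundle_of n g == j) u R n g.+1 = 1.
Proof.
move=> le_m lt_j.
(* The even good solves [g./2 = j], the odd one [n - 2 - g./2 = j]. *)
pose r := [:: (2 * j)%N; (2 * (n - 2 - j)).+1].
rewrite (@sum_ord_seq _ _ (fun g => bundle_of n g == j)
           (fun g => u R n g.+1) r); first last.
- by move=> x; rewrite /bundle_of !inE; do 2?case: ifP; lia.
- by rewrite /= !inE; lia.
rewrite !big_cons big_nil !u_big; try lia.
have -> : (2 * j)./2.+1 = j.+1 by lia.
have -> : (2 * (n - 2 - j)).+1./2.+1 = (n - j.+1)%N by lia.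
rewrite natrB; last by lia.
have : n%:R != 0 :> R by rewrite pnatr_eq0; lia.
by move=> n_neq0; field.
Qed.

Lemma triple_value (R : realFieldType) (n d j : nat) :
  (0 < n <= d)%N -> (n - 1 <= j < d)%N ->
  \sum_(g < 2 * n + 1 + 3 * (d - n) | bundle_of n g == j) u R n g.+1 = 1.
Proof.
move=> hd hj.
(* First of the three consecutive goods labelled [j]. *)
pose a := (2 * n - 2 + 3 * (j - (n - 1)))%N.
rewrite (@sum_ord_seq _ _ (fun g => bundle_of n g == j)
           (fun g => u R n g.+1) [:: a; a.+1; a.+2]); first last.
- by move=> x; rewrite /bundle_of /a !inE; do 2?case: ifP; lia.
- by rewrite /= !inE; lia.
by rewrite !big_cons big_nil !u_third /a; try lia; field.
Qed.

Theorem lemma15 (R : realFieldType) (n d m : nat)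
    (hn : (2 <= n)%N)
    (hd : d = ((4 * n - 2) %/ 3)%N)
    (hm : m = (2 * n + 1 + 3 * (d - n))%N) :
  ordered (identical_instance R n m) /\ normalized d (identical_instance R n m).
Proof.
(* As [n >= 2] gives [4n - 2 >= 3n], the floor is at least [n] and the truncated [d - n] is the true
   difference. *)
have le_nd : (0 < n <= d)%N by lia.
split.
  exists 1%g => i j k le_jk; rewrite !perm1.
  by apply: u_nonincreasing => //; lia.
move=> i; exists (fun j : 'I_d => [set g : 'I_m | bundle_of n g == j]); split.
  split=> [|j k neq_jk].
    apply/setP=> g; rewrite in_setT; apply/bigcupP.
    have lt_g : (bundle_of n g < d)%N.
      by apply: bundle_of_lt => //; rewrite -hm.
    by exists (Ordinal lt_g); rewrite ?inE.
  rewrite -setI_eq0; apply/eqP/setP=> g; rewrite !inE.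
  by apply/negP=> /andP[/eqP-> /eqP/val_inj]; apply/eqP.
move=> j; rewrite /bundle_value; under eq_bigl do rewrite inE.
have lt_j := ltn_ord j.
have [lt_jn|ge_jn] := ltnP j (n - 1)%N; first by apply: pair_value => //; lia.
by rewrite hm; apply: triple_value => //; lia.
Qed.
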